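(* Let $\{\mathcal{T}(t):t\ge0\}$ be a semigroup in a metric space $(M,d)$ with global attractor $\mathcal{A}$. Assume that there exists a positively invariant neighborhood $\mathcal{U}$ of $\mathcal{A}$ such that $\mathcal{T}:=\mathcal{T}(1)|_{\mathcal{U}}:\mathcal{U}\to\mathcal{U}$ is Lipschitz, with Lipschitz constant $L_1$, and there exist $C,\gamma>0$ such that $$dist_H(\mathcal{T}^n\,\mathcal{U},\mathcal{A})\le Ce^{-\gamma n},\qquad\forall n\in\mathbb{N}.$$ Then there exist $C_2>0$ and $\alpha\in(0,1)$ such that if $0<\delta<1$ and $\{x_n\}_{n\in\mathbb{Z}}\subset\mathcal{U}$ is a $\delta$-pseudo orbit of $\mathcal{T}(1)$, then $$d(x_n,\mathcal{A})\le C_2\,\delta^{\alpha},\qquad\forall n\in\mathbb{Z}.$$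
   Context: A semigroup in $(M,d)$ is a family $\{\mathcal{T}(t):t\ge0\}$ of continuous maps $M\to M$ with $\mathcal{T}(0)=I$, $\mathcal{T}(t)\mathcal{T}(s)=\mathcal{T}(t+s)$ for $t,s\ge0$, and $(t,x)\mapsto\mathcal{T}(t)x$ continuous. A set $S$ is positively invariant if $\mathcal{T}(t)S\subset S$ for all $t\ge0$. $dist_H(A_1,A_2)=\sup_{a_1\in A_1}\inf_{a_2\in A_2}d(a_1,a_2)$. A global attractor is a compact set $\mathcal{A}\subset M$ with $\mathcal{T}(t)\mathcal{A}=\mathcal{A}$ for all $t\ge0$ and $dist_H(\mathcal{T}(t)B,\mathcal{A})\to0$ as $t\to+\infty$ for each bounded $B\subset M$. A sequence $\{x_n\}_{n\in\mathbb{Z}}$ is a $\delta$-pseudo orbit of a map $F$ if $d(Fx_n,x_{n+1})\le\delta$ for all $n\in\mathbb{Z}$. $d(x,\mathcal{A})=\inf_{a\in\mathcal{A}}d(x,a)$. *)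

(* Defs.v *)
From HB Require Import structures.
From mathcomp Require Import all_boot all_order all_algebra.
From mathcomp Require Import all_classical all_reals all_analysis.
Set Implicit Arguments.
Unset Strict Implicit.
Unset Printing Implicit Defensive.
Import Order.TTheory GRing.Theory Num.Theory.
Import numFieldNormedType.Exports.
Local Open Scope classical_set_scope.
Local Open Scope ring_scope.

(* Extended-real valued, with value +oo when A is empty. *)
Definition dist_set (R : realType) (M : metricType R) (x : M) (A : set M)
    : \bar R :=
  ereal_inf [set (mdist x a)%:E | a in A].

(* The supremum is taken in [0, +oo], so that distH set0 A2 = 0 (a bare
   ereal_sup would give -oo). In particular the empty bounded set satisfies the
   attraction condition below. *)
Definition distH (R : realType) (M : metricType R) (A1 A2 : set M) : \bar R :=
  maxe 0%E (ereal_sup [set dist_set a1 A2 | a1 in A1]).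

(* Boundedness by finite diameter; the library's bounded_set is restricted to
   normed spaces. *)
Definition metric_bounded (R : realType) (M : metricType R) (B : set M) : Prop :=
  exists K : R, forall x y, B x -> B y -> mdist x y <= K.

(* Time is an arbitrary real; the values T t for t < 0 are irrelevant. *)
Record semigroup (R : realType) (M : metricType R) (T : R -> M -> M) : Prop := {
  semigroup_cont : forall t, 0 <= t -> continuous (T t) ;
  semigroup0 : forall x, T 0 x = x ;
  semigroupD : forall t s, 0 <= t -> 0 <= s ->
    forall x, T t (T s x) = T (t + s) x ;
  semigroup_joint_cont :
    {within [set tx : R * M | 0 <= tx.1],
      continuous (fun tx : R * M => T tx.1 tx.2)} }.

Definition positively_invariant (R : realType) (M : metricType R)
    (T : R -> M -> M) (S : set M) : Prop :=
  forall t, 0 <= t -> T t @` S `<=` S.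

Record global_attractor (R : realType) (M : metricType R) (T : R -> M -> M)
    (A : set M) : Prop := {
  attractor_compact : compact A ;
  attractor_invariant : forall t, 0 <= t -> T t @` A = A ;
  attractor_attracts : forall B : set M, metric_bounded B ->
    distH (T t @` B) A @[t --> +oo] --> 0%E }.

(* Metric-space counterpart of the library's L.-lipschitz_U F, which requires
   normed spaces. *)
Definition metric_lipschitz (R : realType) (M : metricType R) (L : R)
    (U : set M) (F : M -> M) : Prop :=
  forall x y, U x -> U y -> mdist (F x) (F y) <= L * mdist x y.

Definition pseudo_orbit (R : realType) (M : metricType R) (delta : R)
    (F : M -> M) (x : int -> M) : Prop :=
  forall n : int, mdist (F (x n)) (x (n + 1)) <= delta.

(* Main.v *)
(** Iterating the Lipschitz bound, the segment of length k of a pseudo orbit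
    ending at x_n deviates from the true orbit of x_(n-k) by at most
    [delta * L ^+ k], while the k-th iterate of that point is within
    [C * expR (- gamma * k)] of A.  Writing L = e^l and taking
    [k ~ - ln delta / (l + gamma)] makes both errors of order
    delta^(gamma / (l + gamma)). *)
Require Import Defs.
From HB Require Import structures.
From mathcomp Require Import all_boot all_order all_algebra.
From mathcomp Require Import all_classical all_reals all_analysis.
From mathcomp Require Import ring lra.
Set Implicit Arguments.
Unset Strict Implicit.
Unset Printing Implicit Defensive.
Import Order.TTheory GRing.Theory Num.Theory.
Import numFieldNormedType.Exports.
Local Open Scope classical_set_scope.
Local Open Scope ring_scope.

Lemma dist_set_triangle (R : realType) (M : metricType R) (x y : M) (A : set M) :
  (dist_set x A <= (mdist x y)%:E + dist_set y A)%E.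
Proof.
rewrite -leeBlDl //; apply: le_ereal_inf_tmp => _ [a Aa <-].
rewrite leeBlDl //; apply: (@le_trans _ _ (mdist x a)%:E).
  by apply: ereal_inf_lbound; exists a.
by rewrite -EFinD lee_fin metric_triangle.
Qed.

Lemma dist_set_le_distH (R : realType) (M : metricType R) (x : M)
    (A1 A2 : set M) :
  A1 x -> (dist_set x A2 <= distH A1 A2)%E.
Proof.
move=> A1x; rewrite /distH le_max; apply/orP; right.
by apply: ereal_sup_ubound; exists x.
Qed.

(** One more step multiplies the accumulated error by at most [L] and adds a jump of at most
    [delta], so the error obeys the recursion of a geometric sum. Invariance of [U] keeps the true
    orbit where the Lipschitz bound applies. *)
Lemma pseudo_orbit_deviation (R : realType) (M : metricType R) (L delta : R)
    (U : set M) (F : M -> M) (x : int -> M) (m : int) (k : nat) :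
  0 <= L -> F @` U `<=` U -> metric_lipschitz L U F ->
  (forall n, U (x n)) -> pseudo_orbit delta F x ->
  mdist (iter k F (x m)) (x (m + k%:Z)) <= delta * \sum_(i < k) L ^+ i.
Proof.
move=> L0 FU lipF Ux psF.
have Uiter j : U (iter j F (x m)).
  by elim: j => [|j IHj] //=; apply: FU; exists (iter j F (x m)).
elim: k => [|k IHk]; first by rewrite addr0 /= mdistxx big_ord0 mulr0.
apply: le_trans (metric_triangle _ (F (x (m + k%:Z))) _) _.
rewrite big_ord_recl expr0 mulrDr mulr1 addrC lerD //.
  by rewrite -addn1 PoszD addrA; exact: psF.
apply: le_trans (lipF _ _ (Uiter k) (Ux _)) _.
under eq_bigr do rewrite exprS.
by rewrite -mulr_sumr mulrCA; apply: ler_wpM2l.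
Qed.

(** The sum times [L - 1] equals [L ^+ k - 1], and [L - 1] is at least 1. *)
Lemma geometric_sum_le (R : realDomainType) (L : R) (k : nat) :
  2 <= L -> \sum_(i < k) L ^+ i <= L ^+ k.
Proof.
move=> L2; have sum0 : 0 <= \sum_(i < k) L ^+ i.
  by apply: sumr_ge0 => i _; apply: exprn_ge0; apply: le_trans L2.
have := subrX1 L k; nra.
Qed.

Lemma balanced_exponent (R : realType) (l gamma delta : R) :
  0 < l -> 0 < gamma -> 0 < delta < 1 ->
  let alpha := gamma / (l + gamma) in
  exists k : nat, delta * expR (l * k%:R) <= delta `^ alpha /\
    expR (- gamma * k%:R) <= expR gamma * delta `^ alpha.
Proof.
move=> l0 g0 /andP[d0 d1] alpha.
have lnd : ln delta < 0 by rewrite ln_lt0 // d0.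
pose t := - ln delta / (l + gamma).
have t0 : 0 <= t by rewrite divr_ge0 ?oppr_ge0 ?ltW // addr_gt0.
have lg0 : l + gamma != 0 by rewrite gt_eqF // addr_gt0.
have ltE : ln delta = - (l + gamma) * t by rewrite /t; field.
have powE : delta `^ alpha = expR (- gamma * t).
  by rewrite /powR gt_eqF // ltE /alpha; congr expR; field.
(* Rounding down only shrinks the growing term; since [t < k + 1], the decaying term loses at most
   the factor [expR gamma]. *)
exists (Num.trunc t); have /andP[] := truncn_itv t0.
rewrite -natr1; set k := (Num.trunc t)%:R => kt tk.
rewrite powE -{1}(lnK d0) ltE -!expRD !ler_expR; split; nra.
Qed.

Theorem lemma4p1 (R : realType) (M : metricType R) (T : R -> M -> M)
    (A U : set M) (L1 C gamma : R)
    (hT : semigroup T)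
    (hA : global_attractor T A)
    (hU_nbhs : set_nbhs A U)
    (hU_inv : positively_invariant T U)
    (hLip : metric_lipschitz L1 U (T 1))
    (hC : 0 < C) (hgamma : 0 < gamma)
    (hexp : forall n : nat,
      (distH (iter n (T 1%R) @` U) A <= (C * expR (- gamma * n%:R))%:E)%E) :
  exists C2 alpha : R, [/\ 0 < C2, 0 < alpha < 1 &
    forall (delta : R) (x : int -> M),
      0 < delta < 1 ->
      (forall n : int, U (x n)) ->
      pseudo_orbit delta (T 1) x ->
      forall n : int, (dist_set (x n) A <= (C2 * delta `^ alpha)%:E)%E].
Proof.
(* Enlarging [L1] gives [2 <= L], as the geometric sum bound requires, and [ln L > 0], which forces
   the exponent below 1. *)
pose L : R := `|L1| + 2.
have L2 : 2 <= L by rewrite lerDr.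
have lipL : metric_lipschitz L U (T 1).
  move=> x y Ux Uy; apply: le_trans (hLip x y Ux Uy) _.
  apply: ler_wpM2r; first exact: mdist_ge0.
  by apply: le_trans (ler_norm _) _; rewrite lerDl.
pose l := ln L.
have L0 : 0 < L by apply: lt_le_trans L2.
have l0 : 0 < l by rewrite ln_gt0 // (lt_le_trans _ L2) // ltr1n.
(* The 1 pays for the deviation from the true orbit, [C * expR gamma] for the attraction with its
   rounding loss. *)
exists (1 + C * expR gamma), (gamma / (l + gamma)); split.
- by rewrite addr_gt0 // mulr_gt0 // expR_gt0.
- rewrite divr_gt0 ?addr_gt0 //= ltr_pdivrMr ?addr_gt0 // mul1r.
  by rewrite ltrDr.
move=> delta x d01 Ux psx n.
have [k [dk gk]] := balanced_exponent l0 hgamma d01.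
(* Indexing by all integers allows starting [k] steps back, whatever [n] is. *)
pose y := iter k (T 1) (x (n - k%:Z)).
have dist_iter : (dist_set y A <= (C * expR (- gamma * k%:R))%:E)%E.
  apply: le_trans (hexp k); apply: dist_set_le_distH.
  by exists (x (n - k%:Z)).
have := pseudo_orbit_deviation (n - k%:Z) k (ltW L0) (hU_inv _ ler01) lipL Ux psx.
rewrite subrK -/y => dev.
apply: le_trans (dist_set_triangle _ y _) _.
apply: le_trans (leeD2l _ dist_iter) _.
rewrite -EFinD lee_fin metric_sym mulrDl mul1r lerD //.
- apply: le_trans dev (le_trans _ dk).
  rewrite expRM_natr lnK //; apply: ler_wpM2l; last exact: geometric_sum_le.
  by case/andP: d01 => /ltW.
- by rewrite -mulrA ler_wpM2l // ltW.
Qed.
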